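(* Let $k>1$, and consider an element of $\mathcal P_k$ in normal form $v^\ddagger u$, where $u,v\in\{0,\dots,k-1\}^*$. Then $$\theta_k(v^\ddagger u)=R^\ddagger_{k^{len(v)},\,num(v)}\,R_{k^{len(u)},\,num(u)}.$$
   Context: $\mathbb N=\{0,1,2,\dots\}$. $\mathcal I(\mathbb N)$ is the symmetric inverse monoid on $\mathbb N$: all partial injections $\mathbb N\to\mathbb N$ under composition of partial functions ($fg$ means first $g$, then $f$), with generalised inverse $f^\ddagger(y)=x$ iff $f(x)=y$. For $a>b\in\mathbb N$, $R_{a,b}\in\mathcal I(\mathbb N)$ has domain $\{an+b:n\in\mathbb N\}$ and $R_{a,b}(n)=\frac{n-b}{a}$. $\mathcal P_k$ (the $k$-th polycyclic monoid) is the inverse monoid with zero $\epsilon$ generated by $\{0,\dots,k-1\}$ subject to $xy^\ddagger=Id$ if $x=y$ and $xy^\ddagger=\epsilon$ if $x\neq y$; words in the free monoid $\{0,\dots,k-1\}^*$ are regarded as elements of $\mathcal P_k$. $\theta_k:\mathcal P_k\to\mathcal I(\mathbb N)$ is the injective inverse monoid homomorphism with $\theta_k(x)=R_{k,x}$ for $0\le x<k$. For a word $w\in\{0,\dots,k-1\}^*$, $len(w)$ is its length, and $num(w)\in\mathbb N$ is the number it represents in base $k$ (leading zeros allowed): $num$ of the empty word is $0$, $num(x)=x$ for a letter $x$, and $num(wx)=k\cdot num(w)+num(x)$. *)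

(* Defs.v *)
From HB Require Import structures.
From mathcomp Require Import all_boot.
From mathcomp Require Import boolp classical_sets.

Set Implicit Arguments.
Unset Strict Implicit.
Unset Printing Implicit Defensive.

Import Algebra.

Local Open Scope quotient_scope.
Local Open Scope group_scope.

Reserved Notation "x ^‡" (at level 1, format "x ^‡").

HB.mixin Record Monoid_isInverseMonoid0 M of Monoid M := {
  dagger : M -> M;
  eps : M;
  mulgdK : forall x : M, x * dagger x * x = x;
  mulgKd : forall x : M, dagger x * x * dagger x = dagger x;
  dagger_uniq : forall x y : M, x * y * x = x -> y * x * y = y -> y = dagger x;
  mul0g : forall x : M, eps * x = eps;
  mulg0 : forall x : M, x * eps = eps
}.

#[short(type="inverseMonoid0Type")]
HB.structure Definition InverseMonoid0 :=
  {M of Monoid_isInverseMonoid0 M & Monoid M}.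

Arguments eps {s}.
Notation "x ^‡" := (dagger x) : group_scope.

(* Partial injections on nat: f m = None means that m is outside the domain. *)
Record pinj := Pinj {
  pfun :> nat -> option nat;
  pfun_inj : forall m n p, pfun m = Some p -> pfun n = Some p -> m = n
}.

Notation "'I(ℕ)'" := pinj.

Lemma pinjP (f g : I(ℕ)) : f =1 g -> f = g.
Proof.
case: f g => f fI [g gI] /= fg.
by have E : f = g by [apply/funext]; subst g; congr Pinj; exact: Prop_irrelevance.
Qed.

HB.instance Definition _ := gen_eqMixin pinj.
HB.instance Definition _ := gen_choiceMixin pinj.

Lemma pid_subproof (m n p : nat) : Some m = Some p -> Some n = Some p -> m = n.
Proof. by move=> -[->] [->]. Qed.

Definition pid : I(ℕ) := Pinj pid_subproof.

Lemma pempty_subproof (m n p : nat) : None = Some p -> None = Some p -> m = n.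
Proof. by []. Qed.

Definition pempty : I(ℕ) := @Pinj (fun _ => None) pempty_subproof.

Lemma pcomp_subproof (f g : I(ℕ)) m n p :
  obind f (g m) = Some p -> obind f (g n) = Some p -> m = n.
Proof.
case gm: (g m) => [a|] //=; case gn: (g n) => [b|] //= fa fb.
by move: gn; rewrite -(pfun_inj fa fb); exact: pfun_inj.
Qed.

Definition pcomp (f g : I(ℕ)) : I(ℕ) := Pinj (@pcomp_subproof f g).

Definition pinv_fun (f : I(ℕ)) (y : nat) : option nat :=
  xget None (Some @` [set x | f x = Some y])%classic.

Lemma pinv_funP (f : I(ℕ)) y x : pinv_fun f y = Some x <-> f x = Some y.
Proof.
rewrite /pinv_fun; split; first by case: xgetP => [_ -> [z /= fz <-] [<-] //|].
move=> fx; apply: xget_unique; first by exists x.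
by move=> _ [z /= fz <-]; rewrite (pfun_inj fz fx).
Qed.

Lemma pinv_subproof (f : I(ℕ)) m n p :
  pinv_fun f m = Some p -> pinv_fun f n = Some p -> m = n.
Proof. by move=> /pinv_funP fp /pinv_funP; rewrite fp => -[]. Qed.

Definition pinv (f : I(ℕ)) : I(ℕ) := Pinj (@pinv_subproof f).

Lemma pcompA : associative pcomp.
Proof. by move=> f g h; apply: pinjP => m /=; case: (h m). Qed.

Lemma pcomp1f : left_id pid pcomp.
Proof. by move=> f; apply: pinjP => m /=; case: (f m). Qed.

Lemma pcompf1 : right_id pid pcomp.
Proof. by move=> f; apply: pinjP. Qed.

HB.instance Definition _ := isSemigroup.Build pinj pcompA.
HB.instance Definition _ := Semigroup_isMonoid.Build pinj pcomp1f pcompf1.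

Lemma pcompVK (f : I(ℕ)) : f * pinv f * f = f.
Proof.
apply: pinjP => m /=; case fm: (f m) => [y|] //=.
by have /pinv_funP -> /= := fm.
Qed.

Lemma pcompKV (f : I(ℕ)) : pinv f * f * pinv f = pinv f.
Proof.
apply: pinjP => y /=; case fy: (pinv_fun f y) => [m|] //=.
by have /pinv_funP -> /= := fy.
Qed.

Lemma pinv_uniq (f g : I(ℕ)) : f * g * f = f -> g * f * g = g -> g = pinv f.
Proof.
move=> fgf gfg; have gP y x : g y = Some x <-> f x = Some y.
  split=> [gy|fx].
    have /= := congr1 (fun h : pinj => h y) gfg; rewrite gy /=.
    case fx: (f x) => [z|] //= gz.
    by rewrite (pfun_inj gz gy).
  have /= := congr1 (fun h : pinj => h x) fgf; rewrite fx /=.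
  case gy: (g y) => [z|] //= fz.
  by rewrite (pfun_inj fz fx).
apply: pinjP => y /=; case gy: (g y) => [x|].
  by symmetry; apply/pinv_funP/gP.
case fy: (pinv_fun f y) => [x|//].
by move/pinv_funP/gP: fy; rewrite gy.
Qed.

Lemma pcomp0f (f : I(ℕ)) : pempty * f = pempty.
Proof. by apply: pinjP => m /=; case: (f m). Qed.

Lemma pcompf0 (f : I(ℕ)) : f * pempty = pempty.
Proof. exact: pinjP. Qed.

HB.instance Definition _ := Monoid_isInverseMonoid0.Build pinj
  pcompVK pcompKV pinv_uniq pcomp0f pcompf0.

Definition R_fun (a b m : nat) : option nat :=
  if (b <= m) && (a %| m - b) then Some ((m - b) %/ a) else None.

Lemma R_subproof a b m n p :
  R_fun a b m = Some p -> R_fun a b n = Some p -> m = n.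
Proof.
rewrite /R_fun; case: andP => // -[bm am] [<-]; case: andP => // -[bn an] [E].
by rewrite -(subnK bm) -(subnK bn) -(divnK am) -(divnK an) E.
Qed.

(* Only meaningful for b < a; see num_ltn for the case of base-k words. *)
Definition R (a b : nat) : I(ℕ) := Pinj (@R_subproof a b).

Lemma R_someP a b m n : b < a -> R a b m = Some n <-> m = a * n + b.
Proof.
move=> ba; have a0 : 0 < a by exact: leq_ltn_trans ba.
rewrite /= /R_fun; split=> [|->].
  by case: andP => // -[bm am] [<-]; rewrite mulnC divnK // subnK.
by rewrite leq_addl addnK dvdn_mulr // mulKn.
Qed.

(* The polycyclic monoid: terms over the generators modulo the least congruence
   whose quotient is an inverse monoid with zero satisfying the relations. *)
Inductive pterm (k : nat) : Type :=
  | TGen of 'I_k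
  | TOne
  | TEps
  | TMul of pterm k & pterm k
  | TDagger of pterm k.
Arguments TOne {k}.
Arguments TEps {k}.

Inductive pcongr (k : nat) : pterm k -> pterm k -> Prop :=
  | PRefl s : pcongr s s
  | PSym s t : pcongr s t -> pcongr t s
  | PTrans s t r : pcongr s t -> pcongr t r -> pcongr s r
  | PMul s s' t t' :
      pcongr s s' -> pcongr t t' -> pcongr (TMul s t) (TMul s' t')
  | PDagger s s' : pcongr s s' -> pcongr (TDagger s) (TDagger s')
  | PMulA s t r : pcongr (TMul s (TMul t r)) (TMul (TMul s t) r)
  | PMul1g s : pcongr (TMul TOne s) s
  | PMulg1 s : pcongr (TMul s TOne) s
  | PMuldK s : pcongr (TMul (TMul s (TDagger s)) s) s
  | PMulKd s : pcongr (TMul (TMul (TDagger s) s) (TDagger s)) (TDagger s)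
  | PDaggerUniq s t :
      pcongr (TMul (TMul s t) s) s -> pcongr (TMul (TMul t s) t) t ->
      pcongr t (TDagger s)
  | PMul0g s : pcongr (TMul TEps s) TEps
  | PMulg0 s : pcongr (TMul s TEps) TEps
  | PGenV x : pcongr (TMul (TGen x) (TDagger (TGen x))) TOne
  | PGenNeq x y : x != y -> pcongr (TMul (TGen x) (TDagger (TGen y))) TEps.

Section Polycyclic.
Variable k : nat.

HB.instance Definition _ := gen_eqMixin (pterm k).
HB.instance Definition _ := gen_choiceMixin (pterm k).

Definition pcongrb (s t : pterm k) : bool := `[< pcongr s t >].

Lemma pcongrb_refl : reflexive pcongrb.
Proof. by move=> s; apply/asboolP/PRefl. Qed.

Lemma pcongrb_sym : symmetric pcongrb.
Proof. by move=> s t; apply/asboolP/asboolP => /PSym. Qed.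

Lemma pcongrb_trans : transitive pcongrb.
Proof. by move=> t s r /asboolP st /asboolP tr; apply/asboolP/(PTrans st). Qed.

Canonical pcongr_equiv := EquivRel pcongrb pcongrb_refl pcongrb_sym pcongrb_trans.

Definition polycyclic := {eq_quot pcongr_equiv}.

HB.instance Definition _ := Choice.on polycyclic.
HB.instance Definition _ : EqQuotient _ pcongr_equiv polycyclic :=
  EqQuotient.on polycyclic.

Local Notation P := polycyclic.
Local Notation cl := (\pi_P : pterm k -> P).

Lemma pi_pcongr s t : cl s = cl t <-> pcongr s t.
Proof. by split=> [/eqmodP/asboolP|st] //; apply/eqmodP/asboolP. Qed.

Definition poly_mul (a b : P) : P := cl (TMul (repr a) (repr b)).
Definition poly_dagger (a : P) : P := cl (TDagger (repr a)).

Lemma repr_pcongr s : pcongr (repr (cl s)) s.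
Proof. by apply/pi_pcongr; rewrite reprK. Qed.

Lemma pi_mul s t : poly_mul (cl s) (cl t) = cl (TMul s t).
Proof. by apply/pi_pcongr/PMul; exact: repr_pcongr. Qed.

Lemma pi_dagger s : poly_dagger (cl s) = cl (TDagger s).
Proof. by apply/pi_pcongr/PDagger; exact: repr_pcongr. Qed.

Lemma pi_ind (Q : P -> Prop) : (forall s, Q (cl s)) -> forall a, Q a.
Proof. by move=> H a; rewrite -[a]reprK. Qed.

Lemma poly_mulA : associative poly_mul.
Proof.
elim/pi_ind=> s; elim/pi_ind=> t; elim/pi_ind=> r.
by rewrite !pi_mul; apply/pi_pcongr/PMulA.
Qed.

Lemma poly_mul1g : left_id (cl TOne) poly_mul.
Proof. by elim/pi_ind=> s; rewrite pi_mul; apply/pi_pcongr/PMul1g. Qed.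

Lemma poly_mulg1 : right_id (cl TOne) poly_mul.
Proof. by elim/pi_ind=> s; rewrite pi_mul; apply/pi_pcongr/PMulg1. Qed.

HB.instance Definition _ := isSemigroup.Build P poly_mulA.
HB.instance Definition _ := Semigroup_isMonoid.Build P poly_mul1g poly_mulg1.

Lemma poly_mulgdK (a : P) : a * poly_dagger a * a = a.
Proof.
elim/pi_ind: a => s; rewrite pi_dagger /mul /= !pi_mul.
exact/pi_pcongr/PMuldK.
Qed.

Lemma poly_mulgKd (a : P) : poly_dagger a * a * poly_dagger a = poly_dagger a.
Proof.
elim/pi_ind: a => s; rewrite pi_dagger /mul /= !pi_mul.
exact/pi_pcongr/PMulKd.
Qed.

Lemma poly_dagger_uniq (a b : P) :
  a * b * a = a -> b * a * b = b -> b = poly_dagger a.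
Proof.
elim/pi_ind: a => s; elim/pi_ind: b => t; rewrite pi_dagger /mul /= !pi_mul.
by move=> /pi_pcongr ? /pi_pcongr ?; apply/pi_pcongr/PDaggerUniq.
Qed.

Lemma poly_mul0g (a : P) : cl TEps * a = cl TEps.
Proof. by elim/pi_ind: a => s; rewrite /mul /= pi_mul; apply/pi_pcongr/PMul0g. Qed.

Lemma poly_mulg0 (a : P) : a * cl TEps = cl TEps.
Proof. by elim/pi_ind: a => s; rewrite /mul /= pi_mul; apply/pi_pcongr/PMulg0. Qed.

HB.instance Definition _ := Monoid_isInverseMonoid0.Build P
  poly_mulgdK poly_mulgKd poly_dagger_uniq poly_mul0g poly_mulg0.

Definition gen (x : 'I_k) : P := cl (TGen x).

Lemma gen_dagger (x y : 'I_k) : gen x * (gen y)^‡ = if x == y then 1 else eps.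
Proof.
rewrite /mul /dagger /= pi_dagger pi_mul; case: eqVneq => [->|xy].
  exact/pi_pcongr/PGenV.
exact/pi_pcongr/PGenNeq.
Qed.

Definition word (w : seq 'I_k) : P := \prod_(x <- w) gen x.

Fixpoint eval (M : inverseMonoid0Type) (f : 'I_k -> M) (s : pterm k) : M :=
  match s with
  | TGen x => f x
  | TOne => 1
  | TEps => eps
  | TMul s t => eval f s * eval f t
  | TDagger s => (eval f s)^‡
  end.

Lemma eval_pcongr (M : inverseMonoid0Type) (f : 'I_k -> M) :
  (forall x y, f x * (f y)^‡ = if x == y then 1 else eps) ->
  forall s t, pcongr s t -> eval f s = eval f t.
Proof.
move=> fP s t; elim=> //=; clear s t.
- by move=> s t r _ -> _ ->.
- by move=> s s' t t' _ -> _ ->.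
- by move=> s s' _ ->.
- by move=> s t r; rewrite mulgA.
- by move=> s; rewrite mul1g.
- by move=> s; rewrite mulg1.
- by move=> s; rewrite mulgdK.
- by move=> s; rewrite mulgKd.
- by move=> s t _ ? _ ?; apply: dagger_uniq.
- by move=> s; rewrite mul0g.
- by move=> s; rewrite mulg0.
- by move=> x; rewrite fP eqxx.
- by move=> x y /negPf xy; rewrite fP xy.
Qed.

Lemma R_dagger (x y : 'I_k) :
  R k x * (R k y)^‡ = if x == y then 1 else eps :> I(ℕ).
Proof.
apply: pinjP => n; rewrite [LHS]/=.
have -> : pinv_fun (R k y) n = Some (k * n + y)%N.
  by apply/pinv_funP/R_someP.
have Rx := R_someP (k * n + y) _ (ltn_ord x).
case: eqVneq => [<-|xy]; first by apply/R_someP.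
rewrite [RHS]/= -[LHS]/(R k x (k * n + y)%N); case E: (R k x _) => [m|//].
move/Rx: E => E; case/eqP: xy; apply: val_inj => /=.
by have /(congr1 (modn^~ k)) := E; rewrite ![(k * _)%N]mulnC !modnMDl !modn_small.
Qed.

(* The morphism induced by x |-> R k x; it is the only one by theta_uniq. *)
Definition theta (a : P) : I(ℕ) := eval (fun x : 'I_k => R k x) (repr a).

Lemma theta_pi s : theta (cl s) = eval (fun x : 'I_k => R k x) s.
Proof. by apply: eval_pcongr; [exact: R_dagger | exact: repr_pcongr]. Qed.

Lemma theta_gen (x : 'I_k) : theta (gen x) = R k x.
Proof. by rewrite /gen theta_pi. Qed.

Lemma thetaM : {morph theta : a b / a * b}.
Proof.
elim/pi_ind=> s; elim/pi_ind=> t.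
by rewrite [mul (cl s) _]pi_mul !theta_pi.
Qed.

Lemma theta1 : theta 1 = 1.
Proof. exact: theta_pi. Qed.

Lemma theta0 : theta eps = eps.
Proof. exact: theta_pi. Qed.

Lemma theta_dagger : {morph theta : a / a^‡}.
Proof. by elim/pi_ind=> s; rewrite [dagger (cl s)]pi_dagger !theta_pi. Qed.

Lemma theta_uniq (h : P -> I(ℕ)) :
  h 1 = 1 -> h eps = eps -> {morph h : a b / a * b} ->
  (forall x, h (gen x) = R k x) -> h =1 theta.
Proof.
move=> h1 h0 hM hg; elim/pi_ind=> s; rewrite theta_pi.
have hV a : h a^‡ = (h a)^‡.
  by apply: dagger_uniq; rewrite -!hM ?mulgdK ?mulgKd.
elim: s => [x|||s IHs t IHt|s IHs] //=; first exact: hg.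
- by rewrite -IHs -IHt -hM -pi_mul.
- by rewrite -IHs -hV -pi_dagger.
Qed.

Definition num (w : seq 'I_k) : nat := foldl (fun n (x : 'I_k) => k * n + x)%N 0 w.

Lemma num_rcons w x : num (rcons w x) = (k * num w + x)%N.
Proof. by rewrite /num foldl_rcons. Qed.

Lemma num_ltn w : num w < (k ^ size w)%N.
Proof.
elim/last_ind: w => [//|w x IH]; rewrite num_rcons size_rcons expnS.
apply: (@leq_trans (k * (num w).+1)); last by rewrite leq_mul2l IH orbT.
by rewrite mulnS addnC ltn_add2r.
Qed.

End Polycyclic.

Arguments eval {k M}.

(* Main.v *)
Require Import Defs.
From mathcomp Require Import all_boot.

(** Since [theta] preserves products and daggers, it suffices to compute it on words. [R a b]
    inverts [n |-> a * n + b], so [R a b * R c d] inverts [n |-> c * (a * n + b) + d]; induction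
    from the last letter then matches the recursion of [num]. *)

(* With [a = k ^ size w], [b = num w], [c = k] and [d = x], the indices on the
   right are those of the word [rcons w x]: appending a letter is a Horner step. *)
Lemma R_mul (a b c d : nat) : b < a -> d < c ->
  (R a b * R c d)%g = R (c * a) (c * b + d).
Proof.
move=> ba dc; have bda : c * b + d < c * a.
  apply: (@leq_trans (c * b.+1)); last by rewrite leq_mul2l ba orbT.
  by rewrite mulnS addnC ltn_add2r.
have E n : c * (a * n + b) + d = c * a * n + (c * b + d).
  by rewrite mulnDr mulnA addnA.
apply: pinjP => m; rewrite -[LHS]/(obind (R a b) (R c d m)).
case Em: (R (c * a) (c * b + d) m) => [n|].
  move/(R_someP _ _ bda): Em; rewrite -E => /(R_someP _ _ dc) -> /=.
  exact/(R_someP _ _ ba).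
(* A value on the left would, by [E], put [m] in the domain on the right. *)
case Ec: (R c d m) => [p|//]; rewrite [LHS]/=.
case Ea: (R_fun a b p) => [n|//].
move/(R_someP _ _ dc): Ec; move/(R_someP _ _ ba): Ea => ->.
by rewrite E => /(R_someP _ _ bda); rewrite Em.
Qed.

Lemma theta_word (k : nat) (w : seq 'I_k) :
  theta (word w) = R (k ^ size w) (num w).
Proof.
elim/last_ind: w => [|w x IHw].
  (* The empty word gives [R 1 0], the identity. *)
  rewrite /word big_nil theta1; apply: pinjP => m.
  by symmetry; apply/R_someP; rewrite // mul1n addn0.
have -> : word (rcons w x) = (word w * gen x)%g by rewrite /word big_rcons.
by rewrite thetaM IHw theta_gen R_mul ?num_ltn // num_rcons size_rcons expnS.
Qed.

Theorem theorem35 (k : nat) (k_gt1 : 1 < k) (u v : seq 'I_k) :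
  theta ((word v)^‡ * word u)%g =
  ((R (k ^ size v) (num v))^‡ * R (k ^ size u) (num u))%g.
Proof. by rewrite thetaM theta_dagger !theta_word. Qed.
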